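(* Let $G$ be a finitely generated virtually free group. Then the doubly generalized conjugacy problem with respect to rational subsets of $G$ is decidable; that is, there is an algorithm which, on input two rational subsets $K_1,K_2$ of $G$, decides whether there exist $x\in K_1$ and $y\in K_2$ such that $x$ and $y$ are conjugate in $G$.
   Context: A group is virtually free if it has a free subgroup of finite index. Let $X$ be a finite generating set of $G$, $\widetilde X=X\cup X^{-1}$, and $\pi:\widetilde X^*\to G$ the canonical surjective monoid homomorphism. A subset $K\subseteq G$ is rational if $K=L\pi$ for some rational (regular) language $L\subseteq\widetilde X^*$. A rational subset is given as input by a finite state automaton recognizing a language $L\subseteq\widetilde X^*$ with $L\pi=K$. Two elements $x,y\in G$ are conjugate if $x=z^{-1}yz$ for some $z\in G$. *)

(* Defs.v *)
From mathcomp Require Import all_boot.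

Set Implicit Arguments.
Unset Strict Implicit.
Unset Printing Implicit Defensive.

(* Total mu-recursive functions of several arguments: minimization is only    *)
(* applied to regular functions, so every function of the class is total.     *)
Inductive recursive : forall n : nat, (n.-tuple nat -> nat) -> Prop :=
| recursive_zero n : recursive (fun _ : n.-tuple nat => 0)
| recursive_succ : recursive (fun t : 1.-tuple nat => (thead t).+1)
| recursive_proj n (i : 'I_n) : recursive (fun t : n.-tuple nat => tnth t i)
| recursive_comp m n (f : m.-tuple nat -> nat) (g : 'I_m -> n.-tuple nat -> nat) :
    recursive f -> (forall i, recursive (g i)) ->
    recursive (fun t : n.-tuple nat => f [tuple g i t | i < m])
| recursive_primrec n (f : n.-tuple nat -> nat) (g : n.+2.-tuple nat -> nat)
    (h : n.+1.-tuple nat -> nat) :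
    recursive f -> recursive g ->
    (forall t : n.-tuple nat, h [tuple of 0 :: t] = f t) ->
    (forall k (t : n.-tuple nat), h [tuple of k.+1 :: t] =
                 g [tuple of k :: h [tuple of k :: t] :: t]) ->
    recursive h
| recursive_mu n (f : n.+1.-tuple nat -> nat) (h : n.-tuple nat -> nat) :
    recursive f ->
    (forall t : n.-tuple nat, f [tuple of h t :: t] = 0) ->
    (forall (t : n.-tuple nat) k, k < h t -> f [tuple of k :: t] != 0) ->
    recursive h.

(* Nondeterministic finite automata over A, given by finite lists; the states *)
(* are the natural numbers occurring in these lists.                          *)
Record nfa (A : Type) := NFA {
  initial : seq nat;
  final : seq nat;
  edges : seq (nat * A * nat)  (* (source, label, target) *)
}.

Section Automata.

Variable A : countType.
Implicit Types (M : nfa A) (p : nat) (w : seq A).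

Fixpoint accepts_from M p w : bool :=
  if w is a :: w' then
    has (fun e => (e.1 == (p, a)) && accepts_from M e.2 w') (edges M)
  else p \in final M.

Definition accepts M w := has (fun p => accepts_from M p w) (initial M).

Definition nfa_code M : nat := pickle (initial M, final M, edges M).

Definition nfa_rel_decidable (P : nfa A -> nfa A -> Prop) : Prop :=
  exists2 f : 2.-tuple nat -> nat, recursive f &
    forall M1 M2, f [tuple nfa_code M1; nfa_code M2] = 1 <-> P M1 M2.

End Automata.

Section Groups.

Local Open Scope group_scope.

Variable G : groupType.

(* Words over a family x and its formal inverses: the letter (i, false)       *)
(* stands for x i and (i, true) for its inverse.                              *)
Definition letter_val (I : Type) (x : I -> G) (a : I * bool) : G :=
  if a.2 then (x a.1)^-1 else x a.1.

Definition word_val (I : Type) (x : I -> G) (w : seq (I * bool)) : G :=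
  \prod_(a <- w) letter_val x a.

Definition reduced (I : eqType) (w : seq (I * bool)) : bool :=
  sorted (fun a c => c != (a.1, ~~ a.2)) w.

Definition generates (I : Type) (x : I -> G) : Prop :=
  forall g, exists w, word_val x w = g.

(* H is free on the family b: every element of H is the value of exactly one  *)
(* reduced word, i.e. b induces an isomorphism from the group of reduced      *)
(* words onto H.                                                              *)
Definition free_on (H : {pred G}) (I : eqType) (b : I -> G) : Prop :=
  (forall i, b i \in H) /\
  (forall h, h \in H -> exists! w, reduced w /\ word_val b w = h).

Definition free_subgroup (H : {pred G}) : Prop :=
  group_closed H /\ exists (I : eqType) (b : I -> G), free_on H b.

(* G is covered by finitely many right cosets of H. *)
Definition finite_index (H : {pred G}) : Prop :=
  exists s : seq G, forall g, exists2 t, t \in s & g / t \in H.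

Definition virtually_free : Prop :=
  exists2 H : {pred G}, free_subgroup H & finite_index H.

Definition conjugate (x y : G) : Prop := exists z, x = z^-1 * y * z.

Definition rational_subset n (X : n.-tuple G) (M : nfa ('I_n * bool)) (g : G) :
    Prop :=
  exists2 w, accepts M w & word_val (tnth X) w = g.

End Groups.

(* Main.v *)
(* In a virtually free group, let h be the reduced word of the free part of g.
   Call two elements R-close if their words h differ only after a common prefix,
   by at most c letters.  Although R is not invariant, the ratios of R-close
   elements form a finite set B, and R is a chordal graph, because a word of
   maximal length is simplicial.  So every closed walk in the Cayley graph can be
   triangulated with chords in B, and the elements of B that label a path from p
   to q are found by composing edges without ever leaving B.  Triangulating the
   quadrilateral z x = y z with z of minimal length shows that, after
   rotating the words x and y, either they are conjugate by an element of B, or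
   both lie in a fixed finite set, whose conjugacy table is a constant of the
   algorithm.  Both cases are path questions in a finite graph built from the two
   automata.  Membership in the least relation is a bounded quantification over
   bit masks, hence recursive. *)
Require Import Defs.
From mathcomp Require Import all_boot.
From mathcomp Require Import boolp.

Set Implicit Arguments.
Unset Strict Implicit.
Unset Printing Implicit Defensive.

(** * Recursive functions *)

(* The arguments are presented as an environment [nat -> nat], so that the
   shift of the variables under a binder is a conversion. *)
Definition computable n (F : (nat -> nat) -> nat) : Prop :=
  recursive (fun t : n.-tuple nat => F (nth 0 t)).

Lemma computable_tuple n (f : n.-tuple nat -> nat) F :
  recursive f -> (forall t, f t = F (nth 0 t)) -> computable n F.
Proof. by move=> rf fF; rewrite /computable -(_ : f = fun t => F (nth 0 t)) //; apply/funext. Qed.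

Lemma computable_ext n F G : F =1 G -> computable n F -> computable n G.
Proof. by move=> /funext ->. Qed.

Lemma computable_var n i : i < n -> computable n (fun e => e i).
Proof.
move=> lti; apply: (computable_tuple (recursive_proj (Ordinal lti))) => t.
by rewrite (tnth_nth 0).
Qed.

(* The variables of [F] beyond the [m]-th must read [0], the default of [nth]. *)
Lemma computable_subst m n F (g : nat -> (nat -> nat) -> nat) :
  computable m F -> (forall i, i < m -> computable n (g i)) ->
  (forall i (t : n.-tuple nat), m <= i -> g i (nth 0 t) = 0) ->
  computable n (fun e => F (g^~ e)).
Proof.
move=> rF rg g0.
apply: (computable_tuple (recursive_comp rF (fun i => rg i (ltn_ord i)))) => t.
congr F; apply/funext => i; case: (ltnP i m) => [lti|lei].
  by rewrite -(tnth_nth 0 _ (Ordinal lti)) tnth_mktuple.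
by rewrite g0 // nth_default ?size_tuple.
Qed.

Lemma computable_comp1 n (f : nat -> nat) F :
  computable 1 (fun e => f (e 0)) -> computable n F -> computable n (fun e => f (F e)).
Proof.
move=> rf rF; apply: (@computable_subst 1 n _ (fun i e => if i is 0 then F e else 0) rf).
- by case.
- by case.
Qed.

Lemma computable_comp2 n (f : nat -> nat -> nat) F1 F2 :
  computable 2 (fun e => f (e 0) (e 1)) -> computable n F1 -> computable n F2 ->
  computable n (fun e => f (F1 e) (F2 e)).
Proof.
move=> rf r1 r2.
apply: (@computable_subst 2 n _
  (fun i e => match i with 0 => F1 e | 1 => F2 e | _ => 0 end) rf).
- by case=> [|[]].
- by case=> [|[]].
Qed.

Lemma computable_succ n F : computable n F -> computable n (fun e => (F e).+1).
Proof.
apply: (computable_comp1 (f := S)); apply: (computable_tuple recursive_succ) => t.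
by rewrite /thead (tnth_nth 0).
Qed.

Lemma computable_const n c : computable n (fun=> c).
Proof. by elim: c => [|c IH]; [exact: recursive_zero | exact: computable_succ]. Qed.

Lemma computable_primrec n (F : (nat -> nat) -> nat -> nat) G :
  computable n (fun e => F e 0) ->
  computable n.+2 (fun e => G (fun i => e i.+2) (e 0) (e 1)) ->
  (forall e k, F e k.+1 = G e k (F e k)) ->
  computable n.+1 (fun e => F (fun i => e i.+1) (e 0)).
Proof. by move=> r0 rG FS; apply: (recursive_primrec r0 rG) => // k t; apply: FS. Qed.

(** [computable_primrec] keeps the counter as variable [0]; substituting [b] for it allows recursion
    up to any computable bound. *)
Lemma computable_rec n (F : (nat -> nat) -> nat -> nat) G b :
  computable n (fun e => F e 0) ->
  computable n.+2 (fun e => G (fun i => e i.+2) (e 0) (e 1)) ->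
  (forall e k, F e k.+1 = G e k (F e k)) ->
  computable n b -> computable n (fun e => F e (b e)).
Proof.
move=> r0 rG FS rb.
apply: (@computable_subst n.+1 n _ (fun i e => if i is i'.+1 then e i' else b e)
  (computable_primrec r0 rG FS)) => [[|i] lti|[//|i] t lei] //.
- exact: computable_var.
- by rewrite nth_default ?size_tuple.
Qed.

Lemma computable_add n F1 F2 :
  computable n F1 -> computable n F2 -> computable n (fun e => F1 e + F2 e).
Proof.
apply: computable_comp2.
apply: (@computable_rec 2 (fun e k => e 0 + k) (fun e k r => r.+1)).
- by under eq_fun do rewrite addn0; apply: computable_var.
- exact/computable_succ/computable_var.
- by move=> e k; rewrite addnS.
- exact: computable_var.
Qed.

Lemma computable_mul n F1 F2 :
  computable n F1 -> computable n F2 -> computable n (fun e => F1 e * F2 e).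
Proof.
apply: computable_comp2.
apply: (@computable_rec 2 (fun e k => e 0 * k) (fun e k r => e 0 + r)).
- by under eq_fun do rewrite muln0; apply: computable_const.
- by apply: computable_add; apply: computable_var.
- by move=> e k; rewrite mulnS.
- exact: computable_var.
Qed.

Lemma computable_pred n F : computable n F -> computable n (fun e => (F e).-1).
Proof.
apply: computable_comp1.
apply: (@computable_rec 1 (fun e k => k.-1) (fun e k r => k)) => //.
- exact: computable_const.
- exact: computable_var.
- exact: computable_var.
Qed.

Lemma computable_sub n F1 F2 :
  computable n F1 -> computable n F2 -> computable n (fun e => F1 e - F2 e).
Proof.
apply: computable_comp2.
apply: (@computable_rec 2 (fun e k => e 0 - k) (fun e k r => r.-1)).
- by under eq_fun do rewrite subn0; apply: computable_var.
- exact/computable_pred/computable_var.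
- by move=> e k; rewrite subnS.
- exact: computable_var.
Qed.

Lemma computable_exp2 n F : computable n F -> computable n (fun e => 2 ^ F e).
Proof.
apply: computable_comp1.
apply: (@computable_rec 1 (fun e k => 2 ^ k) (fun e k r => 2 * r)).
- exact: computable_const.
- by apply: computable_mul; [exact: computable_const | exact: computable_var].
- by move=> e k; rewrite expnS.
- exact: computable_var.
Qed.

Lemma computable_neg n (P : _ -> bool) :
  computable n P -> computable n (fun e => ~~ P e).
Proof.
move=> rP; apply: (@computable_ext n (fun e => 1 - P e)) => [e|]; first by case: (P e).
by apply: computable_sub => //; apply: computable_const.
Qed.

Lemma computable_and n (P Q : _ -> bool) :
  computable n P -> computable n Q -> computable n (fun e => P e && Q e).
Proof.
move=> rP rQ; apply: (@computable_ext n (fun e => P e * Q e)) => [e|].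
  by rewrite mulnb.
exact: computable_mul.
Qed.

Lemma computable_or n (P Q : _ -> bool) :
  computable n P -> computable n Q -> computable n (fun e => P e || Q e).
Proof.
move=> rP rQ; apply: (@computable_ext n (fun e => ~~ (~~ P e && ~~ Q e))) => [e|].
  by rewrite negb_and !negbK.
by apply/computable_neg/computable_and; apply/computable_neg.
Qed.

Lemma computable_imply n (P Q : _ -> bool) :
  computable n P -> computable n Q -> computable n (fun e => P e ==> Q e).
Proof.
move=> rP rQ; apply: (@computable_ext n (fun e => ~~ P e || Q e)) => [e|].
  by rewrite implybE.
by apply: computable_or => //; apply/computable_neg.
Qed.

Lemma computable_leq n F1 F2 :
  computable n F1 -> computable n F2 -> computable n (fun e => F1 e <= F2 e).
Proof.
move=> r1 r2; apply: (@computable_ext n (fun e => 1 - (F1 e - F2 e))) => [e|].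
  by rewrite /leq; case: (F1 e - F2 e).
by apply: computable_sub; [exact: computable_const | exact: computable_sub].
Qed.

Lemma computable_eq n F1 F2 :
  computable n F1 -> computable n F2 -> computable n (fun e => F1 e == F2 e).
Proof.
move=> r1 r2; apply: (@computable_ext n (fun e => (F1 e <= F2 e) && (F2 e <= F1 e))) => [e|].
  by rewrite eqn_leq.
by apply: computable_and; apply: computable_leq.
Qed.

Lemma computable_odd n F : computable n F -> computable n (fun e => odd (F e)).
Proof.
apply: (computable_comp1 (f := odd)).
apply: (@computable_rec 1 (fun e k => odd k) (fun e k r => 1 - r)).
- exact: computable_const.
- by apply: computable_sub; [exact: computable_const | exact: computable_var].
- by move=> e k /=; case: odd.
- exact: computable_var.
Qed.

(** The halves of [k] and [k.+1] add up to [k], which turns halving into a primitive recursion. *)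
Lemma computable_half n F : computable n F -> computable n (fun e => (F e)./2).
Proof.
apply: computable_comp1.
apply: (@computable_rec 1 (fun e k => k./2) (fun e k r => k - r)).
- exact: computable_const.
- by apply: computable_sub; apply: computable_var.
- by move=> e k; rewrite -[X in _ = X - _](odd_double_half k) -addnn addnA addnK -uphalf_half.
- exact: computable_var.
Qed.

Definition bit (c i : nat) : bool := odd (iter i half c).

Lemma computable_bit n F1 F2 :
  computable n F1 -> computable n F2 -> computable n (fun e => bit (F1 e) (F2 e)).
Proof.
apply: (@computable_comp2 n bit); apply/computable_odd.
apply: (@computable_rec 2 (fun e k => iter k half (e 0)) (fun e k r => r./2)) => //.
- exact: computable_var.
- exact/computable_half/computable_var.
- exact: computable_var.
Qed.

(** * Bounded and finite quantifiers *)

Definition ex_lt (n : nat) (P : pred nat) : bool := has P (iota 0 n).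
Definition all_lt (n : nat) (P : pred nat) : bool := all P (iota 0 n).

Lemma ex_ltP n (P : pred nat) : reflect (exists2 k, k < n & P k) (ex_lt n P).
Proof.
by apply: (iffP hasP) => -[k kn Pk]; exists k => //; move: kn; rewrite mem_iota.
Qed.

Lemma all_ltP n (P : pred nat) : reflect (forall k, k < n -> P k) (all_lt n P).
Proof.
by apply: (iffP allP) => H k kn; apply: H; move: kn; rewrite mem_iota.
Qed.

Lemma computable_ex n F (P : (nat -> nat) -> nat -> bool) :
  computable n F -> computable n.+1 (fun e => P (fun i => e i.+1) (e 0)) ->
  computable n (fun e => ex_lt (F e) (P e)).
Proof.
move=> rF rP.
apply: (@computable_rec n (fun e k => ex_lt k (P e)) (fun e k r => P e k || (0 < r))) => //.
- exact: computable_const.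
- apply: computable_or; last first.
    by apply: computable_leq; [exact: computable_const | exact: computable_var].
  (* The predicate has to skip variable [1], which holds the previous value of the recursion. *)
  apply: (@computable_subst n.+1 n.+2 _ (fun i e => if i is i'.+1 then e i'.+2 else e 0) rP)
    => [[|i] lti|[//|i] t lei].
  + exact: computable_var.
  + exact: computable_var.
  + by rewrite nth_default ?size_tuple.
- move=> e k; rewrite /ex_lt -[k.+1]addn1 iotaD has_cat /= orbF orbC add0n.
  by case: has.
Qed.

Lemma computable_all n F (P : (nat -> nat) -> nat -> bool) :
  computable n F -> computable n.+1 (fun e => P (fun i => e i.+1) (e 0)) ->
  computable n (fun e => all_lt (F e) (P e)).
Proof.
move=> rF rP.
apply: (@computable_ext n (fun e => ~~ ex_lt (F e) (fun k => ~~ P e k))) => [e|].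
  by rewrite /ex_lt has_predC negbK.
by apply: computable_neg; apply: (computable_ex (P := fun e k => ~~ P e k)) => //;
  apply: computable_neg.
Qed.

(** As [K] is fixed, the quantifier is a finite disjunction, and computability is asked of each
    instance separately. *)
Lemma computable_exists (K : finType) n (P : (nat -> nat) -> pred K) :
  (forall k, computable n (P^~ k)) -> computable n (fun e => [exists k, P e k]).
Proof.
move=> rP; apply: (@computable_ext n (fun e => has (P e) (enum K))) => [e|].
  by congr nat_of_bool; apply/hasP/existsP => [[k _ Pk]|[k Pk]]; exists k; rewrite ?mem_enum.
by elim: (enum K) => [|k s IH]; [exact: computable_const | exact: computable_or].
Qed.

Lemma computable_forall (K : finType) n (P : (nat -> nat) -> pred K) :
  (forall k, computable n (P^~ k)) -> computable n (fun e => [forall k, P e k]).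
Proof.
move=> rP; apply: (@computable_ext n (fun e => ~~ [exists k, ~~ P e k])) => [e|].
  by rewrite negb_exists; congr nat_of_bool; apply: eq_forallb => k; rewrite negbK.
by apply/computable_neg/computable_exists => k; apply: computable_neg.
Qed.

(** * Pairing *)

Definition pair_code (a b : nat) : nat := pickle (a, b).

(** A pair is pickled as a list of two entries: from the lowest bit on, [a] zeros, a one, [b] zeros,
    a one. *)
Lemma pair_codeE a b : pair_code a b = 2 ^ a * (2 ^ b).*2.+1.
Proof. by rewrite [LHS](_ : _ = 2 ^ a * (2 ^ b * 1).*2.+1) // muln1. Qed.

Lemma computable_pair n F1 F2 :
  computable n F1 -> computable n F2 -> computable n (fun e => pair_code (F1 e) (F2 e)).
Proof.
move=> r1 r2.
apply: (@computable_ext n (fun e => 2 ^ F1 e * (2 * 2 ^ F2 e).+1)) => [e|].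
  by rewrite pair_codeE mul2n.
apply: computable_mul; first exact: computable_exp2.
apply/computable_succ/computable_mul; first exact: computable_const.
exact: computable_exp2.
Qed.

Lemma computable_insert n j F : j <= n -> computable n F ->
  computable n.+1 (fun e => F (fun i => if i < j then e i else e i.+1)).
Proof.
move=> jn rF; apply: (@computable_subst n n.+1 _ (fun i e => if i < j then e i else e i.+1) rF).
  by move=> i lti; case: (i < j); apply: computable_var => //; apply: leqW.
by move=> i t lei; rewrite ltnNge (leq_trans jn lei) /= nth_default ?size_tuple.
Qed.

Ltac computability_step := cbv beta; first
  [ assumption | by apply: computable_var | apply: computable_const
  | apply: computable_forall => ? | apply: computable_exists => ?
  | apply: computable_and | apply: computable_or | apply: computable_imply
  | apply: computable_neg | apply: computable_eq | apply: computable_leq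
  | apply: computable_bit | apply: computable_pair | apply: computable_exp2
  | apply: computable_ex | apply: computable_all | apply: computable_pred
  | apply: computable_succ | apply: computable_add | apply: computable_mul ].

Ltac computability := repeat computability_step.

Lemma leq_pair_code a b a' b' : a <= a' -> b <= b' -> pair_code a b <= pair_code a' b'.
Proof.
move=> aa bb; rewrite !pair_codeE leq_mul ?ltnS ?leq_double ?leq_exp2l //.
Qed.

Lemma ltn_pair_code a b : (a < pair_code a b) && (b < pair_code a b).
Proof. by have /= := CodeSeq.ltn_code [:: a; b]; rewrite andbT. Qed.

Lemma bit_doubleD (b : bool) c i : bit (b + c.*2) i.+1 = bit c i.
Proof. by rewrite /bit iterSr half_bit_double. Qed.

Lemma bitset_exists (P : pred nat) n :
  exists2 S, S < 2 ^ n & forall i, i < n -> bit S i = P i.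
Proof.
elim: n P => [|n IH] P; first by exists 0.
have [S ltS SP] := IH (P \o succn); exists (P 0 + S.*2).
  rewrite expnS mul2n -ltn_double in ltS *.
  by case: (P 0); rewrite ?add1n ?ltn_Sdouble // -ltn_double.
case=> [_|i lti]; last by rewrite bit_doubleD SP.
by rewrite /bit /= oddD odd_double addbF oddb.
Qed.

(** * Least relations closed under a finite composition rule *)

Section LeastRelation.

Variables (K : finType) (T : K -> K -> K -> bool) (base : K -> nat -> nat -> bool).

Inductive generated : K -> nat -> nat -> Prop :=
| generated_base k p q : base k p q -> generated k p q
| generated_comp k1 k2 k p q r : generated k1 p q -> generated k2 q r ->
    T k1 k2 k -> generated k p r.

Definition triple_code (k : K) p q := pair_code (pickle k) (pair_code p q).

Definition triple_bound N := pair_code (\max_(k : K) pickle k) (pair_code N N).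

Definition closed_bits N S : bool :=
  [forall k, all_lt N (fun p => all_lt N (fun q =>
     base k p q ==> bit S (triple_code k p q)))] &&
  [forall k1, [forall k2, [forall k, all_lt N (fun p => all_lt N (fun q =>
     all_lt N (fun r => [&& T k1 k2 k, bit S (triple_code k1 p q) &
       bit S (triple_code k2 q r)] ==> bit S (triple_code k p r))))]]].

(* Membership in the least relation is quantified over all bit masks of
   bounded length, which avoids any fixpoint computation. *)
Definition generatedb N k p q : bool :=
  all_lt (2 ^ (triple_bound N).+1) (fun S => closed_bits N S ==> bit S (triple_code k p q)).

(** The mask of the relation is itself closed, so what lies in all closed masks is generated.
    Conversely, every closed mask contains the generated triples, by induction. *)
Lemma generatedP N k p q :
  (forall k p q, base k p q -> p < N /\ q < N) -> p < N -> q < N ->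
  reflect (generated k p q) (generatedb N k p q).
Proof.
move=> baseN ltp ltq; apply: (iffP (all_ltP _ _)) => [H|gen S _].
  pose P i := if unpickle i is Some (k, (p, q)) then `[< generated k p q >] else false.
  have PE k' p' q' : P (triple_code k' p' q') = `[< generated k' p' q' >].
    by rewrite /P (pickleK (k', (p', q'))).
  have [S ltS SP] := bitset_exists P (triple_bound N).+1.
  have {}SP k' p' q' : p' < N -> q' < N ->
    reflect (generated k' p' q') (bit S (triple_code k' p' q')).
    move=> ltp' ltq'; rewrite SP ?PE; first exact: asboolP.
    rewrite ltnS; apply: leq_pair_code; first exact: leq_bigmax.
    by apply: leq_pair_code; apply: ltnW.
  have /implyP Hb := H S ltS; apply/SP => //; apply: Hb; apply/andP; split.
    apply/forallP => k1; apply/all_ltP => p1 p1N; apply/all_ltP => q1 q1N.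
    by apply/implyP => b; apply/SP => //; apply: generated_base.
  apply/forallP => k1; apply/forallP => k2; apply/forallP => k3.
  apply/all_ltP => p1 p1N; apply/all_ltP => q1 q1N; apply/all_ltP => r1 r1N.
  apply/implyP => /and3P[Tk /SP g1 /SP g2]; apply/SP => //.
  by apply: generated_comp Tk; [exact: g1 | exact: g2].
apply/implyP => /andP[/forallP Sb /forallP SC].
(* The induction carries the bounds along, because [closed_bits] only speaks of vertices below [N],
   the intermediate one included. *)
suff [] : [/\ p < N, q < N & bit S (triple_code k p q)] by [].
elim: gen {ltp ltq} => {k p q} [k p q b|k1 k2 k p q r _ [pN qN S1] _ [_ rN S2] Tk].
  have [pN qN] := baseN _ _ _ b; split => //.
  by move: (Sb k) => /all_ltP/(_ p pN)/all_ltP/(_ q qN)/implyP/(_ b).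
split=> //; move: (SC k1) => /forallP/(_ k2)/forallP/(_ k)/all_ltP/(_ p pN).
by move=> /all_ltP/(_ q qN)/all_ltP/(_ r rN); rewrite Tk S1 S2.
Qed.

End LeastRelation.

Lemma computable_generated n (K : finType) T (base : (nat -> nat) -> K -> nat -> nat -> bool)
    N k Fp Fq :
  (forall k, computable n.+2 (fun e => base (fun i => e i.+2) k (e 1) (e 0))) ->
  computable n N -> computable n Fp -> computable n Fq ->
  computable n (fun e => generatedb T (base e) (N e) k (Fp e) (Fq e)).
Proof.
move=> rb rN rp rq.
have w m F : computable m F -> computable m.+1 (fun e => F (fun i => e i.+1)).
  exact: (@computable_insert m 0).
have {}rb k' : computable n.+3 (fun e => base (fun i => e i.+3) k' (e 1) (e 0)).
  exact: (@computable_insert n.+2 2 _ _ (rb k')).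
rewrite /generatedb /triple_bound /closed_bits /triple_code.
have wN := w _ _ rN; have wwN := w _ _ wN; have wwwN := w _ _ wwN.
have wp := w _ _ rp; have wq := w _ _ rq.

computability.
exact: rb.
Qed.

(** * Codes of lists *)

Lemma bit_exp2M n c i : bit (2 ^ n * c) i = (n <= i) && bit c (i - n).
Proof.
elim: n i => [|n IH] i; first by rewrite mul1n subn0.
rewrite expnS -mulnA mul2n; case: i => [|i]; first by rewrite /bit /= odd_double.
by rewrite -[_.*2]add0n (bit_doubleD false) IH subSS.
Qed.

Lemma bit_cons n c i :
  bit (2 ^ n * c.*2.+1) i = (n == i) || (n < i) && bit c (i - n.+1).
Proof.
rewrite bit_exp2M; case: ltngtP => //= [ni|->]; last by rewrite subnn /bit /= odd_double.
by rewrite -[c.*2.+1]add1n -(subnSK ni) (bit_doubleD true).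
Qed.

Lemma bit_ltn c i : bit c i -> i < c.
Proof.
elim: i c => [|i IH] c; first by case: c.
rewrite /bit iterSr => /IH ic; rewrite -[c in _ < c]odd_double_half -addnn.
apply: leq_trans (leq_addl _ _); rewrite -addn1; apply: leq_add => //.
exact: leq_ltn_trans ic.
Qed.

(* In the binary expansion of [CodeSeq.code s] the entries of [s] are the
   lengths of the blocks of zeros that precede the successive ones. *)
Definition code_mem (x c : nat) : bool :=
  ex_lt c (fun i => [&& (i == 0) || bit c i.-1,
    all_lt x (fun j => ~~ bit c (i + j)) & bit c (i + x)]).

(** Induction on the list: the head is the lowest block, and a block that starts at [i] in the code
    of the tail starts at [(n + i).+1] in the whole code. *)
Lemma code_memE x s : code_mem x (CodeSeq.code s) = (x \in s).
Proof.
apply/ex_ltP/idP => [[i _]|].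
  elim: s i => [|n s IH] i; first by case/and3P=> _ _ /bit_ltn.
  rewrite /= -/(CodeSeq.code s) in_cons; set c := CodeSeq.code s.
  case/and3P=> i0 /all_ltP blk.
  case: i i0 blk => [|i] /=.
    rewrite bit_cons => _ blk; case: eqP => [->|_ /= /andP[nx _]]; first by rewrite eqxx.
    by have := blk n nx; rewrite bit_cons eqxx.
  rewrite [bit _ i]bit_cons => i0 blk ix; apply/orP; right.
  have ni : n <= i by case/orP: i0 => [/eqP ->|/andP[/ltnW]].
  have bE j : bit (2 ^ n * c.*2.+1) (i.+1 + j) = bit c (i - n + j).
    have nij : n < i.+1 + j by rewrite addSn ltnS (leq_trans ni) ?leq_addr.
    by rewrite bit_cons (ltn_eqF nij) nij addSn subSS addnBAC.
  apply: (IH (i - n)); apply/and3P; split.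
  - case/orP: i0 => [/eqP ->|/andP[ltni b]]; first by rewrite subnn.
    by rewrite -subnS b orbT.
  - by apply/all_ltP => j jx; rewrite -bE blk.
  - by move: ix; rewrite bE.
elim: s => [//|n s IH]; rewrite in_cons => xs.
suff [i Hi] : exists i, [&& (i == 0) || bit (CodeSeq.code (n :: s)) i.-1,
    all_lt x (fun j => ~~ bit (CodeSeq.code (n :: s)) (i + j)) &
    bit (CodeSeq.code (n :: s)) (i + x)].
  exists i => //; case/and3P: Hi => _ _ /bit_ltn; exact/leq_trans/leq_addr.
rewrite /= -/(CodeSeq.code s); set c := CodeSeq.code s.
case/predU1P: xs => [->|/IH[i _]].
  exists 0; apply/and3P; split=> //; last by rewrite bit_cons eqxx.
  by apply/all_ltP => j jn; rewrite bit_cons add0n gtn_eqF // ltnNge ltnW.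
case/and3P=> i0 /all_ltP blk b; exists (n + i).+1; apply/and3P; split.
- rewrite /= bit_cons; case/orP: i0 => [/eqP ->|b']; first by rewrite addn0 eqxx.
  case: i b' {blk b} => [|i] b'; first by rewrite addn0 eqxx.
  by rewrite addnS ltnS leq_addr subSS addKn b' orbT.
- apply/all_ltP => j jx; rewrite bit_cons addSn subSS -addnA addKn.
  by rewrite (negPf (blk j jx)) andbF orbF ltn_eqF // ltnS leq_addr.
- by rewrite bit_cons addSn subSS -addnA addKn b ltnS leq_addr orbT.
Qed.

Lemma computable_code_mem n F1 F2 :
  computable n F1 -> computable n F2 -> computable n (fun e => code_mem (F1 e) (F2 e)).
Proof.
apply: (@computable_comp2 n code_mem); rewrite /code_mem.
computability.
Qed.

(** * A chordal graph on a virtually free group *)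

Lemma exists_argmax (T : eqType) (f : T -> nat) (s : seq T) : s != [::] ->
  exists2 v, v \in s & forall x, x \in s -> f x <= f v.
Proof.
case: s => // x0 s _; elim: s x0 => [|y s IH] x0.
  by exists x0; rewrite ?mem_head // => x /[!inE] /eqP ->.
have [v vs vmax] := IH y; case: (leqP (f v) (f x0)) => [le|lt].
  exists x0; rewrite ?mem_head // => x; rewrite inE => /predU1P[->//|/vmax].
  by move/leq_trans; apply.
exists v; rewrite 1?inE ?vs ?orbT // => x; rewrite inE => /predU1P[->|/vmax//].
exact: ltnW.
Qed.

Lemma bounded_words (T : eqType) (J : seq T) c :
  exists W : seq (seq T), forall w, {subset w <= J} -> size w <= c -> w \in W.
Proof.
elim: c => [|c [W WP]]; first by exists [:: [::]] => w _; rewrite leqn0 size_eq0 inE.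
exists ([::] :: [seq a :: w | a <- J, w <- W]) => -[|a w] wJ //; rewrite ltnS inE => wc.
by apply/allpairsP; exists (a, w); split=> //=; [apply: wJ; rewrite mem_head
  |apply: WP => // x xw; apply: wJ; rewrite inE xw orbT].
Qed.

(** * Words with a common suffix *)

Section SharedSuffix.

Variable T : eqType.
Implicit Types u v w : seq T.

(** Words are kept with their changing end in front, as words of inverses. So the common prefix of
    two free parts appears as a common suffix [p], and [c] bounds the letters outside it. *)
Definition near c u v :=
  exists u' v' p, [/\ u = u' ++ p, v = v' ++ p & size u' + size v' <= c].

Lemma near_refl c u : near c u u.
Proof. by exists [::], [::], u. Qed.

Lemma near_sym c u v : near c u v -> near c v u.
Proof. by case=> u' [v' [p [-> -> le]]]; exists v', u', p; rewrite addnC. Qed.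

Lemma cat_suffix (a b c d : seq T) : a ++ b = c ++ d -> size b <= size d ->
  exists2 e, d = e ++ b & a = c ++ e.
Proof.
elim: c a => [|x c IH] [|y a] //=; first by move=> ->; exists [::]; rewrite ?cats0.
- by move=> <- _; exists (y :: a).
- by move=> -> /=; rewrite size_cat ltnNge leq_addl.
- by case=> -> /IH H /H[e -> ->]; exists e.
Qed.

(* The relation [near c] is chordal: seen from the empty word, two points
   close to a farthest point are close to each other. *)
Lemma near_farthest c x v y : size x <= size v -> size y <= size v ->
  near c x v -> near c v y -> near c x y.
Proof.
wlog: x y / exists x' v' p v'' y' q, [/\ x = x' ++ p, v = v' ++ p,
    v = v'' ++ q & y = y' ++ q] /\ [/\ size x' + size v' <= c,
    size v'' + size y' <= c & size p <= size q].
  move=> W lx ly [x' [v' [p [ex ev le1]]]] [v'' [y' [q [ev' ey le2]]]].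
  case: (leqP (size p) (size q)) => pq.
    apply: W => //; first by exists x', v', p, v'', y', q.
      by exists x', v', p.
    by exists v'', y', q.
  apply: near_sym; apply: W => //.
  - exists y', v'', q, v', x', p; split; rewrite // 1?addnC ?[size v' + _]addnC.
    by split=> //; rewrite 1?addnC // ltnW.
  - by exists y', v'', q; rewrite addnC.
  - by exists v', x', p; rewrite addnC.
case=> x' [v' [p [v'' [y' [q [[ex ev ev' ey] [le1 le2 pq]]]]]]] _ ly _ _.
(* Both [p] and [q] are suffixes of [v], so the shorter one, [p], is also a suffix of [y]. As [y] is
   no longer than [v], its remainder [y' ++ e] is no longer than [v']. *)
have [|e qe v'e] := @cat_suffix v' p v'' q _ pq; first by rewrite -ev.
exists x', (y' ++ e), p; rewrite ex ey qe catA; split=> //.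
apply: leq_trans le1; rewrite leq_add2l.
by move: ly; rewrite ey ev qe !size_cat addnA leq_add2r.
Qed.

End SharedSuffix.

(** * Reduced words and their multiplication *)

Section ReducedWords.

Local Open Scope group_scope.

Variable I : eqType.
Implicit Types (a : I * bool) (u w : seq (I * bool)).

Definition inv_letter (a : I * bool) := (a.1, ~~ a.2).

Definition consr a u :=
  if u is c :: u' then if c == inv_letter a then u' else a :: u else [:: a].

Lemma reduced_consr a u : reduced u -> reduced (consr a u).
Proof.
case: u => //= c u; case: eqP => [_|/eqP ca] ru; last by rewrite /reduced /= ca.
exact: path_sorted ru.
Qed.

Lemma reduced_foldr k u : reduced u -> reduced (foldr consr u k).
Proof. by move=> ru; elim: k => //= a k; apply: reduced_consr. Qed.

(** Each letter of [k] adds or cancels one letter at the front, which enlarges the part outside the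
    common suffix by at most one. *)
Lemma near_foldr k u : near (size k) u (foldr consr u k).
Proof.
elim: k => [|a k [u' [k' [p [eu ek le]]]]]; first exact: near_refl.
rewrite /= ek eu {ek eu u}; case: k' le => [|c k'] /=; rewrite ?addn0 ?addnS => le.
  case: p => [|c p]; first by exists u', [:: a], [::]; rewrite /= addn1.
  rewrite /=; case: eqP => [ca|_]; last by exists u', [:: a], (c :: p); rewrite /= addn1.
  by exists (rcons u' c), [::], p; rewrite cat_rcons size_rcons addn0.
case: eqP => [ca|_]; last by exists u', [:: a, c & k'], p; rewrite /= !addnS.
by exists u', k', p; split=> //; apply: leq_trans (leqnSn _); apply: ltnW.
Qed.

Lemma mem_foldr k u : {subset foldr consr u k <= k ++ u}.
Proof.
elim: k => //= a k IH x; case: (foldr consr u k) IH => [|c v] IH /=.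
  by rewrite !inE => ->.
case: eqP => _; last first.
  by rewrite inE => /predU1P[->|/IH]; rewrite inE ?eqxx // => ->; rewrite orbT.
by move=> xv; rewrite inE IH ?orbT // inE xv orbT.
Qed.

Variables (G : groupType) (x : I -> G).

Lemma letter_val_inv a : letter_val x (inv_letter a) = (letter_val x a)^-1.
Proof. by case: a => i [] //=; rewrite /letter_val /= invgK. Qed.

Lemma word_val_cons a w : word_val x (a :: w) = letter_val x a * word_val x w.
Proof. by rewrite /word_val big_cons. Qed.

Lemma word_val_nil : word_val x [::] = 1.
Proof. by rewrite /word_val big_nil. Qed.

Lemma word_val_cat w1 w2 : word_val x (w1 ++ w2) = word_val x w1 * word_val x w2.
Proof. by rewrite /word_val big_cat. Qed.

Lemma word_val_foldr k u : word_val x (foldr consr u k) = word_val x k * word_val x u.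
Proof.
elim: k => [|a k IH]; first by rewrite word_val_nil mul1g.
rewrite word_val_cons -mulgA -IH /=; case: (foldr consr u k) => [|c v] /=.
  by rewrite word_val_cons.
case: eqP => [->|_]; last by rewrite [LHS]word_val_cons.
by rewrite word_val_cons letter_val_inv mulgA mulgV mul1g.
Qed.

End ReducedWords.

Arguments consr {I} a u.

(** * Construction of the chordal graph *)

Section ChordalGraph.

Local Open Scope group_scope.

Variable G : groupType.

(** Chordality, in the form of a perfect elimination order on every finite set of vertices. *)
Definition simplicial (R : rel G) := forall s : seq G, s != [::] ->
  exists2 v, v \in s & forall x y, x \in s -> y \in s -> R x v -> R v y -> R x y.

(** [R] is closeness of the words of the free parts, with a constant large enough for right
    multiplication by [L]. As [L] is arbitrary, any finitely many elements can be made to label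
    edges everywhere. *)
Lemma virtually_free_chordal n (X : n.-tuple G) (L : seq G) :
  generates (tnth X) -> virtually_free G -> exists (R : rel G) (B : seq G),
  [/\ reflexive R, symmetric R, forall g a, a \in L -> R g (g * a),
      forall g g', R g g' -> g^-1 * g' \in B & simplicial R].
Proof.
move=> genX [H [Hg [I [b [_ frH]]]] [s cov]].
have HV h : h \in H -> h^-1 \in H by apply: group_closedV.
have HM h h' : h \in H -> h' \in H -> h * h' \in H by apply: group_closedM.
have [rep repP] : {rep : G -> G & forall g, rep g \in s /\ g / rep g \in H}.
  apply: (@choice _ _ (fun g t => t \in s /\ g / t \in H)) => g.
  by have [t ts gt] := cov g; exists t.
have [nf nfP] : {nf & forall h, h \in H -> reduced (nf h) /\ word_val b (nf h) = h}.
  apply: (@choice _ _ (fun h w => h \in H -> reduced w /\ word_val b w = h)) => h.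
  case: (boolP (h \in H)) => [/frH[w [? _]]|_]; last by exists [::].
  by exists w.
have nf_uniq u : reduced u -> word_val b u \in H -> nf (word_val b u) = u.
  move=> ru Hu; have [w [_ wu]] := frH _ Hu.
  by rewrite -(wu _ (nfP _ Hu)); apply: wu.
(* The first factor of [g = (g / rep g) * rep g] is inverted, so that right
multiplication alters only the front of [N g]. *)
pose N g := nf (g / rep g)^-1.
have NP g : reduced (N g) /\ word_val b (N g) = rep g / g.
  by have [? ->] := nfP _ (HV _ (repP g).2); rewrite invgF.
(* The word [N g] has value [rep g / g]. Passing from [g] to [g * a] multiplies this value on the
   left by [kappa (rep g) a (rep (g * a))], which takes finitely many values for finitely many
   [a]. *)
pose kappa (t a t' : G) := t' / a / t.
have NM g a : kappa (rep g) a (rep (g * a)) \in H /\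
    N (g * a) = foldr consr (N g) (nf (kappa (rep g) a (rep (g * a)))).
  set k := kappa _ _ _; have Hk : k \in H.
    have := HM _ _ (HV _ (repP (g * a)).2) (repP g).2.
    by rewrite invgF invgM !mulgA mulgVK.
  split=> //; have [rk vk] := nfP _ Hk; have [rN vN] := NP g.
  have E : word_val b (foldr consr (N g) (nf k)) = rep (g * a) / (g * a).
    by rewrite word_val_foldr vk vN /k /kappa invgM !mulgA mulgVK.
  have HE : rep (g * a) / (g * a) \in H by rewrite -invgF; apply: HV; apply: (repP _).2.
  rewrite {1}/N invgF -E; apply: nf_uniq; last by rewrite E.
  exact: reduced_foldr.
pose letters := [seq letter_val (tnth X) a | a : 'I_n * bool].
pose nfs (M : seq G) :=
  [seq nf (kappa p.1 a p.2) | p <- [seq (t, t') | t <- s, t' <- s], a <- M].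
have nfsP M g a : a \in M -> nf (kappa (rep g) a (rep (g * a))) \in nfs M.
  move=> aM; apply/allpairsP; exists ((rep g, rep (g * a)), a); split=> //=.
  by apply: allpairs_f; apply: (repP _).1.
(* The basis [b] is not known to be finite, but a walk from [1] along the generators only ever
   introduces letters from the finite list [J]. *)
pose J := N 1 ++ flatten (nfs letters).
have NJ g : {subset N g <= J}.
  have [w <-] := genX g; elim/last_ind: w => [|w a IH] y.
    by rewrite word_val_nil mem_cat => ->.
  rewrite -cats1 word_val_cat word_val_cons word_val_nil mulg1 (NM _ _).2.
  move=> /mem_foldr; rewrite mem_cat => /orP[yk|]; last exact: IH.
  rewrite mem_cat; apply/orP; right; apply/flattenP; eexists; last exact: yk.
  exact/nfsP/image_f.
pose c := \max_(w <- nfs L) size w.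
have [W WP] := bounded_words J c.
pose Q := [seq (word_val b w)^-1 * t | w <- W, t <- s].
exists (fun g g' => `[< near c (N g) (N g') >]), [seq y^-1 * z | y <- Q, z <- Q].
split.
- by move=> g; apply/asboolP/near_refl.
- by move=> g g'; apply/asboolP/asboolP; apply: near_sym.
- move=> g a aL; apply/asboolP; rewrite (NM _ _).2.
  have [u' [v' [p [-> -> le]]]] := near_foldr (nf (kappa (rep g) a (rep (g * a)))) (N g).
  exists u', v', p; split=> //; apply: leq_trans le _.
  by apply: leq_bigmax_seq => //; apply: nfsP.
- move=> g g' /asboolP[u [v [p [eu ev le]]]].
  (* The common suffix contributes the same left factor to [g] and [g'], so the ratio only involves
     two elements of the finite list [Q]. *)
  have E h w : N h = w ++ p -> h = (word_val b p)^-1 * ((word_val b w)^-1 * rep h).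
    move=> eN; have [_ e] := NP h; rewrite eN word_val_cat in e.
    by rewrite -[rep h](mulgVK h) -e !mulgA mulgVK mulVg mul1g.
  have QP h w : N h = w ++ p -> size w <= c -> (word_val b w)^-1 * rep h \in Q.
    move=> eN sw; apply: allpairs_f; last exact: (repP h).1.
    by apply: WP sw => y yw; apply: (NJ h); rewrite eN mem_cat yw.
  rewrite [X in X \in _](_ : _ =
    ((word_val b u)^-1 * rep g)^-1 * ((word_val b v)^-1 * rep g')).
    by apply: allpairs_f; apply: QP => //; apply: leq_trans le; rewrite ?leq_addl ?leq_addr.
  by rewrite {1}(E g u) // {1}(E g' v) // !(invgM, invgK) !mulgA mulgK.
move=> S S0; have [v vS vmax] := exists_argmax (size \o N) S0.
exists v => // x y xS yS /asboolP xv /asboolP vy; apply/asboolP.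
by apply: near_farthest xv vy; apply: vmax.
Qed.

End ChordalGraph.

(** * Triangulated walks and annuli *)

Section Sperner.

Variables (G : groupType) (R : rel G).
Hypotheses (Rsym : symmetric R) (Rsimp : simplicial R).

Lemma cycle_remove v s : s != [::] ->
  (forall x y, x \in s -> y \in s -> R x v -> R v y -> R x y) ->
  cycle R (v :: s) -> cycle R s.
Proof.
case: s => // x s _ H; rewrite /= !rcons_path => /and3P[vx -> sv] /=.
by apply: H; rewrite ?mem_head ?mem_last.
Qed.

(* Sperner's lemma: deleting simplicial vertices of the closed walk one by one
   stops at a triangle with one vertex on each arc. *)
Lemma rainbow_triangle s1 s2 s3 : s1 != [::] -> s2 != [::] -> s3 != [::] ->
  cycle R (s1 ++ s2 ++ s3) ->
  exists a b c, [/\ a \in s1, b \in s2, c \in s3 & [/\ R a b, R b c & R c a]].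
Proof.
have cyc_rot t1 t2 : cycle R (t1 ++ t2) = cycle R (t2 ++ t1).
  by rewrite -(rot_size_cat t1) rot_cycle.
have [n] := ubnP (size (s1 ++ s2 ++ s3)); elim: n s1 s2 s3 => // n IH s1 s2 s3 lt_n.
move=> n1 n2 n3 cyc.
have /Rsimp[v vs vsimp] : s1 ++ s2 ++ s3 != [::] by case: s1 n1 {lt_n cyc}.
wlog vs1 : s1 s2 s3 lt_n n1 n2 n3 cyc vs vsimp / v \in s1.
  have rot3 (t1 t2 t3 : seq G) : t2 ++ t3 ++ t1 =i t1 ++ t2 ++ t3.
    by move=> x; rewrite catA; apply: perm_mem; rewrite perm_catC.
  have cyc3 t1 t2 t3 : cycle R (t1 ++ t2 ++ t3) -> cycle R (t2 ++ t3 ++ t1).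
    by rewrite cyc_rot -catA.
  have size3 (t1 t2 t3 : seq G) : size (t2 ++ t3 ++ t1) = size (t1 ++ t2 ++ t3).
    by rewrite catA size_cat addnC -size_cat.
  move=> W; move: (vs); rewrite !mem_cat => /or3P[|v2|v3]; first exact: W.
    have [||||a [b [c [? ? ? [? ? ?]]]]] := W s2 s3 s1 _ n2 n3 n1 (cyc3 _ _ _ cyc).
    - by rewrite (size3 s1).
    - by rewrite (rot3 s1).
    - by move=> x y; rewrite !(rot3 s1); apply: vsimp.
    - exact: v2.
    by exists c, a, b.
  have [||||a [b [c [? ? ? [? ? ?]]]]] := W s3 s1 s2 _ n3 n1 n2 (cyc3 _ _ _ (cyc3 _ _ _ cyc)).
  - by rewrite (size3 s2) (size3 s1).
  - by rewrite (rot3 s2) (rot3 s1).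
  - by move=> x y; rewrite !(rot3 s2) !(rot3 s1); apply: vsimp.
  - exact: v3.
  by exists b, c, a.
case/splitPr: vs1 lt_n n1 cyc vs vsimp => l r lt_n _ cyc vs vsimp.
have cyc1 : cycle R (v :: r ++ s2 ++ s3 ++ l).
  by move: cyc; rewrite -catA cyc_rot /= -!catA.
have sub x : x \in r ++ s2 ++ s3 ++ l -> x \in (l ++ v :: r) ++ s2 ++ s3.
  rewrite !(mem_cat, inE); do !case/orP => [->|]; rewrite ?orbT //.
  by move=> ->.
have cyc2 : cycle R (r ++ s2 ++ s3 ++ l).
  apply: cycle_remove cyc1 => [|x y /sub xs /sub ys]; last exact: vsimp.
  by case: r {lt_n cyc vs vsimp sub} => //; case: s2 n2.
(* If [v] is alone on its arc, its two neighbours on the closed walk lie on the other arcs and are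
   adjacent because [v] is simplicial. Otherwise [v] can be deleted. *)
case: (altP (l ++ r =P [::])) => [|lr0].
  case: l r cyc1 sub vsimp {cyc lt_n vs cyc2} => [|//] [|//] /= cyc1 sub vsimp _.
  rewrite cats0 in cyc1 sub.
  case: s2 n2 cyc1 sub vsimp => // x s2 _ cyc1 sub vsimp.
  case/lastP: s3 n3 cyc1 sub vsimp => // s3 y _.
  rewrite /= -rcons_cat rcons_path last_rcons => /and3P[vx _ yv] sub vsimp.
  exists v, x, y; rewrite !mem_head mem_rcons mem_head; split=> //; split=> //.
  by rewrite Rsym; apply: vsimp => //; rewrite !(inE, mem_cat, mem_rcons) eqxx ?orbT.
have [||a [b [c [al bs cs Rabc]]]] := IH (l ++ r) s2 s3 _ lr0 n2 n3.
- by move: lt_n; rewrite -!catA !size_cat /= addnS ltnS.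
- by rewrite -catA cyc_rot -!catA.
exists a, b, c; split=> //; move: al; rewrite !mem_cat inE.
by case/orP=> ->; rewrite ?orbT.
Qed.

End Sperner.

(** * Walks that read a word *)

Section Walks.

Local Open Scope group_scope.

Variables (G : groupType) (R : rel G) (T : Type) (f : T -> G).
Implicit Types (g h : G) (w : seq T).

Definition trace g w := scanl (fun h a => h * f a) g w.

Lemma last_trace g w : last g (trace g w) = g * \prod_(a <- w) f a.
Proof.
by elim: w g => [|a w IH] g; rewrite ?big_nil ?mulg1 //= big_cons IH mulgA.
Qed.

Lemma trace_take i g w : i <= size w ->
  nth 1 (g :: trace g w) i = g * \prod_(a <- take i w) f a.
Proof.
elim: w i g => [|a w IH] [|i] g //= lei; rewrite ?big_nil ?mulg1 //.
by rewrite big_cons mulgA -IH.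
Qed.

Lemma mem_trace h g w : h \in g :: trace g w ->
  exists2 i, i <= size w & h = g * \prod_(a <- take i w) f a.
Proof.
case/(nthP 1) => i; rewrite /= size_scanl ltnS => lei <-.
by exists i; rewrite // -trace_take.
Qed.

Lemma path_trace g w : (forall g a, R g (g * f a)) -> path R g (trace g w).
Proof. by move=> Rf; elim: w g => //= a w IH g; rewrite Rf IH. Qed.

End Walks.

(** * Conjugators of bounded size *)

Section Annulus.

Local Open Scope group_scope.

Variables (G : groupType) (R : rel G) (B : seq G).
Hypotheses (Rrefl : reflexive R) (Rsym : symmetric R) (Rsimp : simplicial R).
Hypothesis RB : forall g g', R g g' -> g^-1 * g' \in B.

Lemma rev_cons_belast (T : Type) (x : T) s : rev (x :: s) = last x s :: rev (belast x s).
Proof. by rewrite lastI rev_rcons. Qed.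

(** Each side lists both of its ends, so every corner occurs twice and consecutive sides are joined
    by a loop of the reflexive relation [R]. *)
Lemma cycle_quadrilateral x1 t1 x2 t2 x3 t3 x4 t4 :
  path R x1 t1 -> path R x2 t2 -> path R x3 t3 -> path R x4 t4 ->
  last x1 t1 = x2 -> last x2 t2 = last x3 t3 -> x3 = last x4 t4 -> x4 = x1 ->
  cycle R ((x1 :: t1) ++ (x2 :: t2) ++ rev (x3 :: t3) ++ rev (x4 :: t4)).
Proof.
move=> p1 p2 p3 p4 e12 e23 e34 e41.
have Rrev x s : path R x s -> path R (last x s) (rev (belast x s)).
  by move=> p; rewrite rev_path; apply: sub_path p => u v; rewrite Rsym.
have lrev x s : last (last x s) (rev (belast x s)) = x :> G.
  by case: s => //= y s; rewrite rev_cons last_rcons.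
rewrite !rev_cons_belast /= rcons_path; do 3!rewrite ?cat_path ?last_cat /=.
by rewrite !lrev p1 p2 !Rrev // e12 e23 -e34 e41 !Rrefl.
Qed.

Variables (T : finType) (f : T -> G) (word : G -> seq T).
Hypothesis Rf : forall g a, R g (g * f a).
Hypothesis wordK : forall g, \prod_(a <- word g) f a = g.
Local Notation val w := (\prod_(a <- w) f a).

(* If the bridge [z] is as short as possible, then a chord between the two
   copies of [z] joins points at nearly the same height, for otherwise [y * z]
   or [y^-1 * z] would be a shorter bridge. *)
Lemma annulus : exists D : seq G, forall z w1 w2 : seq T,
  val z * val w1 = val w2 * val z -> exists i j,
  (exists2 e, e \in B & val (rot j w2) * e = e * val (rot i w1)) \/
  (val (rot i w1) \in D /\ val (rot j w2) \in D).
Proof.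
pose K := \max_(b <- B) size (word b).
have [W WP] := bounded_words (enum T) K.
have {}WP w : size w <= K -> w \in W by apply: WP => a _; rewrite mem_enum.
pose M := [seq val w | w <- W] ++ [seq (val w)^-1 | w <- W].
(* Here [b] labels a chord between the two copies of [z], [m] corrects a difference in height of at
   most [K] letters, and [e] leads from the chord to a vertex on the side of [w1] or [w2]. *)
pose D := [seq e^-1 * d * e | d <- [seq b * m | b <- B, m <- M], e <- B].
exists D => z w1 w2 zE.
have [n] := ubnP (size z); elim: n z zE => // n IH z zE; rewrite ltnS => lezn.
set x := val w1 in zE; set y := val w2 in zE.
have takeE i w : val w = val (take i w) * val (drop i w) by rewrite -big_cat cat_take_drop.
have rotE i w : val (rot i w) = (val (take i w))^-1 * val w * val (take i w).
  by rewrite (takeE i w) mulKg /rot big_cat.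
pose Z i := val (take i z).
have ZE i : Z i * val (drop i z) = val z by rewrite -takeE.
have chord i j : i <= size z -> j <= size z -> R (Z i) (y * Z j) ->
    (exists2 z', size z' < size z & val z' * x = y * val z') \/
    (Z i)^-1 * y * Z i \in [seq b * m | b <- B, m <- M].
  move=> lei lej Rij; have bB := RB Rij.
  have sizeB b : b \in B -> size (word b) <= K.
    by move=> ?; apply: leq_bigmax_seq.
  case: (ltnP (i + K) j) => [ltj|jiK]; [left|].
    exists (take i z ++ word ((Z i)^-1 * (y * Z j)) ++ drop j z).
      rewrite !size_cat size_takel // size_drop addnA -[X in _ < X](subnKC lej) ltn_add2r.
      by apply: leq_ltn_trans ltj; rewrite leq_add2l sizeB.
    rewrite !big_cat /= wordK -/(Z i).
    have -> : Z i * ((Z i)^-1 * (y * Z j) * val (drop j z)) = y * val z.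
      by rewrite -(ZE j) !mulgA mulgV mul1g.
    by rewrite -mulgA zE.
  case: (ltnP (j + K) i) => [lti|ijK]; [left|].
    have b'B := RB (etrans (Rsym _ _) Rij).
    exists (take j z ++ word ((y * Z j)^-1 * Z i) ++ drop i z).
      rewrite !size_cat size_takel // size_drop addnA -[X in _ < X](subnKC lei) ltn_add2r.
      by apply: leq_ltn_trans lti; rewrite leq_add2l sizeB.
    rewrite !big_cat /= wordK -/(Z j).
    have -> : Z j * ((y * Z j)^-1 * Z i * val (drop i z)) = y^-1 * val z.
      by rewrite -(ZE i) invgM !mulgA mulgV mul1g.
    by rewrite -mulgA zE mulKg mulVKg.
  right; rewrite (_ : _ * Z i = ((Z i)^-1 * (y * Z j)) * ((Z j)^-1 * Z i)); last first.
    by rewrite !mulgA mulgK.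
  apply: allpairs_f => //; rewrite mem_cat.
  have ZVE k l : k <= l -> (Z k)^-1 * Z l = val (drop k (take l z)).
    by move=> kl; rewrite /Z (takeE k (take l z)) take_takel // mulKg.
  have dE k l : l <= size z -> l <= k + K -> drop k (take l z) \in W.
    by move=> lez lek; apply: WP; rewrite size_drop size_takel // leq_subLR.
  case: (leqP j i) => [ji|/ltnW ij]; first by rewrite ZVE // map_f ?dE.
  rewrite -[_ * Z i]invgK invgM invgK ZVE // orbC.
  by rewrite (map_f (fun w => (val w)^-1)) // dE.
pose s1 := 1 :: trace f 1 z; pose s2 := val z :: trace f (val z) w1.
pose s3 := rev (y :: trace f y z); pose s4 := rev (1 :: trace f 1 w2).
have rev0 (t : seq G) : t != [::] -> rev t != [::] by rewrite -!size_eq0 size_rev.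
have cyc : cycle R (s1 ++ s2 ++ s3 ++ s4).
  by apply: cycle_quadrilateral; rewrite ?path_trace ?last_trace ?mul1g.
(* Merging two sides leaves three arcs. The triangle has a chord from [s2] to [s4], which gives a
   conjugator in [B], or a chord from [s1] to [s3] with a common neighbour on [s2]. Merging the
   other two sides likewise yields such a chord with a common neighbour on [s4]. *)
have [a [v [c [as1 vs2 cs [av vc ca]]]]] : exists a v c,
    [/\ a \in s1, v \in s2, c \in s3 ++ s4 & [/\ R a v, R v c & R c a]].
  by apply: rainbow_triangle => //; rewrite /s3 rev_cons; case: (rev _).
have [c' [u [a' [cs3 us4 as' [cu ua ac]]]]] : exists c u a,
    [/\ c \in s3, u \in s4, a \in s1 ++ s2 & [/\ R c u, R u a & R a c]].
  apply: rainbow_triangle => //; rewrite /s3 /s4; try exact: rev0.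
  by move: cyc; rewrite catA -(rot_cycle (size (s1 ++ s2))) rot_size_cat -catA.
have s1P h : h \in s1 -> exists2 i, i <= size z & h = Z i.
  by move/mem_trace => [i ? ->]; exists i; rewrite ?mul1g.
have s2P h : h \in s2 -> exists i, h = val z * val (take i w1).
  by move/mem_trace => [i _ ->]; exists i.
have s3P h : h \in s3 -> exists2 i, i <= size z & h = y * Z i.
  by rewrite mem_rev => /mem_trace[i ? ->]; exists i.
have s4P h : h \in s4 -> exists i, h = val (take i w2).
  by rewrite mem_rev => /mem_trace[i _ ->]; exists i; rewrite mul1g.
have bridge v' u' : v' \in s2 -> u' \in s4 -> R u' v' -> exists i j,
    (exists2 e, e \in B & val (rot j w2) * e = e * val (rot i w1)) \/
    (val (rot i w1) \in D /\ val (rot j w2) \in D).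
  move=> /s2P[i ->] /s4P[j ->] /RB eB; exists i, j; left; eexists; first exact: eB.
  by rewrite !rotE -/x -/y !mulgA !mulgK -[_ * y * _]mulgA -zE !mulgA.
move: cs; rewrite mem_cat => /orP[cs|cs]; last by apply: bridge vs2 cs _; rewrite Rsym.
move: as'; rewrite mem_cat => /orP[as'|as']; last exact: bridge as' us4 ua.
have [i lei ea] := s1P _ as1; have [j lej ec] := s3P _ cs.
have [i' lei' ea'] := s1P _ as'; have [j' lej' ec'] := s3P _ cs3.
subst a a' c c'; rewrite Rsym in ca.
have [[z' ltz z'E]|Di] := chord _ _ lei lej ca.
  exact: IH z'E (leq_trans ltz lezn).
have [[z' ltz z'E]|Di'] := chord _ _ lei' lej' ac.
  exact: IH z'E (leq_trans ltz lezn).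
have [k ev] := s2P _ vs2; have [l eu] := s4P _ us4; subst v u.
exists k, l; right; split.
  (* Conjugating [y] by a vertex of [s2] gives the rotation of [w1] cut there; [e] labels the edge
     from [Z i] to this vertex. *)
  pose e := (Z i)^-1 * (val z * val (take k w1)).
  have -> : val (rot k w1) = e^-1 * ((Z i)^-1 * y * Z i) * e.
    by rewrite rotE /e !(invgM, invgK) !mulgA !mulgK -[_ * y * val z]mulgA -zE !mulgA mulgVK.
  exact: (allpairs_f (fun d e => e^-1 * d * e) Di (RB av)).
rewrite Rsym in ua; pose e := (Z i')^-1 * val (take l w2).
have -> : val (rot l w2) = e^-1 * ((Z i')^-1 * y * Z i') * e.
  by rewrite rotE /e !(invgM, invgK) !mulgA !mulgK.
exact: (allpairs_f (fun d e => e^-1 * d * e) Di' (RB ua)).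
Qed.

End Annulus.

(** * Saturation *)

Section Saturation.

Local Open Scope group_scope.

Variables (G : groupType) (R : rel G) (B : seq G).
Hypotheses (Rsym : symmetric R) (Rsimp : simplicial R).
Hypothesis RB : forall g g', R g g' -> g^-1 * g' \in B.
Variables (V : eqType) (step : V -> G -> V -> Prop) (S : V -> G -> V -> Prop).
Hypothesis Rstep : forall g v a u, step v a u -> R g (g * a).
Hypothesis Sstep : forall v a u, step v a u -> S v a u.
Hypothesis Scomp : forall v a u b w,
  S v a u -> S u b w -> a * b \in B -> S v (a * b) w.

(** A step is recorded by its label together with its target, so that walks become lists for [path];
    the label paired with the starting vertex is arbitrary. *)
Let edge (x y : G * V) : bool := `[< step x.2 y.1 y.2 >].
Let val (l : seq (G * V)) : G := \prod_(x <- l) x.1.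

Definition walk v g u := exists l : seq (G * V),
  val l = g /\ forall a, path edge (a, v) l /\ (last (a, v) l).2 = u.

Lemma walk_nil v : walk v 1 v.
Proof. by exists [::]; rewrite /val big_nil. Qed.

Lemma walk_step v a u : step v a u -> walk v a u.
Proof.
move=> vu; exists [:: (a, u)]; rewrite /val big_seq1; split=> // b /=.
by rewrite andbT; split=> //; apply/asboolP.
Qed.

Lemma walk_cat v a u b w : walk v a u -> walk u b w -> walk v (a * b) w.
Proof.
move=> [l [<- lP]] [m [<- mP]]; exists (l ++ m); rewrite /val big_cat; split=> // c.
rewrite cat_path last_cat; have [-> lu] := lP c.
by case: (last _ l) lu => d u' /= ->; apply: mP.
Qed.

(** Induction on the length. The rainbow triangle on the first vertex, the inner vertices and the
    last vertex gives an inner vertex adjacent to both ends. It cuts the walk into two shorter ones,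
    which [Scomp] composes within [B]. *)
Lemma path_saturated l g x : l != [::] -> path edge x l -> R g (g * val l) ->
  S x.2 (val l) (last x l).2.
Proof.
have [n] := ubnP (size l); elim: n l g x => // n IH l g x; rewrite ltnS => le_n l0 pl Rl.
have Rtrace m y h : path edge y m -> path R h (trace fst h m).
  elim: m y h => //= z m IHm y h /andP[/asboolP yz pm].
  by rewrite (Rstep _ yz) (IHm z).
case: l l0 le_n pl Rl => // y [|z l] _ le_n pl Rl.
  by move: pl; rewrite /val big_seq1 /= andbT => /asboolP; apply: Sstep.
set m := [:: y, z & l] in le_n pl Rl *.
pose s2 := belast (g * y.1) (trace fst (g * y.1) (z :: l)).
have ms2 : trace fst g m = rcons s2 (g * val m).
  by rewrite -(last_trace fst g m) /s2 /m /= -lastI.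
have [a' [b [c' [ga bs2 gc [Rgb Rb _]]]]] :
  exists a b c, [/\ a \in [:: g], b \in s2, c \in [:: g * val m] &
                    [/\ R a b, R b c & R c a]].
  apply: rainbow_triangle => //.
  rewrite cats1 -ms2; change (is_true (path R g (rcons (trace fst g m) g))).
  by rewrite rcons_path (Rtrace m x g) // last_trace Rsym.
move: ga gc; rewrite !inE => /eqP ga /eqP gc; subst a' c'.
have [i ltis ib] := nthP 1 bs2.
have lti : i.+1 < size m.
  by move: (congr1 size ms2); rewrite size_scanl size_rcons => ->.
have {ib} bE : b = g * val (take i.+1 m).
  rewrite /val -trace_take; last exact: ltnW.
  by change (b = nth 1 (trace fst g m) i); rewrite ms2 nth_rcons ltis.
have mE : val m = val (take i.+1 m) * val (drop i.+1 m).
  by rewrite /val -big_cat cat_take_drop.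
move: pl; rewrite -{1}(cat_take_drop i.+1 m) cat_path => /andP[p1 p2].
rewrite -{2}(cat_take_drop i.+1 m) last_cat mE.
apply: (@Scomp _ _ (last x (take i.+1 m)).2).
- apply: (IH _ g) => //; last by rewrite -bE.
  by rewrite size_takel ?(leq_trans lti) // ltnW.
- apply: (IH _ b) => //; last by rewrite bE -mulgA -mE -bE.
    by rewrite size_drop (leq_trans _ le_n) // ltn_subrL.
  by rewrite -size_eq0 size_drop subn_eq0 -ltnNge.
- by rewrite -mE; have := RB Rl; rewrite mulKg.
Qed.

Lemma walk_saturated v g u : walk v g u -> v <> u -> R 1 g -> S v g u.
Proof.
case=> l [<- lP] vu R1; have [pl lu] := lP 1; rewrite -lu.
apply: (path_saturated _ pl (g := 1)); last by rewrite mul1g.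
by case: l {lP pl R1} lu.
Qed.

End Saturation.

(** * The graph of two automata *)

Section LayeredGraph.

Local Open Scope group_scope.

Variables (G : groupType) (A : finType) (f : A -> G).
Local Notation val w := (\prod_(a <- w) f a).

Fixpoint run (E : A -> nat -> nat -> bool) p w q : Prop :=
  if w is a :: w' then exists2 r, E a p r & run E r w' q else p = q.

Lemma run_cat E p w1 w2 q : run E p (w1 ++ w2) q <-> exists2 r, run E p w1 r & run E r w2 q.
Proof.
elim: w1 p => [|a w IH] p /=.
  by split=> [|[r ->]] //; exists p.
split=> [[r pr /IH[s rs sq]]|[s [r pr rs] sq]]; first by exists s => //; exists r.
by exists r => //; apply/IH; exists s.
Qed.

Variables (E1 E2 : A -> nat -> nat -> bool) (I1 F1 I2 F2 : pred nat).

Definition accepted (E : A -> nat -> nat -> bool) (I F : pred nat) w :=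
  exists p q, [/\ I p, F q & run E p w q].

(* A layer [(j, k)] belongs to the first automaton if [j] is false and to the
   second one, read backwards with inverted labels, if [j] is true; [k] tells
   whether the passage from a final to an initial state has been made.  Hence
   the walks from [((j, false), p)] to [((j, true), p)] read the rotations, cut
   at [p], of the accepted words.  The only edge between the two automata, with
   label [e], joins the chosen states [p0] and [q0]. *)
Definition letter_step (j : bool) (g : G) (p q : nat) : bool :=
  if j then [exists a, (g == (f a)^-1) && E2 a q p]
  else [exists a, (g == f a) && E1 a p q].

Definition seam (j : bool) (p q : nat) : bool := if j then I2 p && F2 q else F1 p && I1 q.

Definition layer_step e p0 q0 (k : bool * bool) g (k' : bool * bool) p q : bool :=
  [|| (k == k') && letter_step k.1 g p q,
      [&& k.1 == k'.1, ~~ k.2, k'.2, g == 1 & seam k.1 p q] |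
      [&& ~~ k.1, k.2, k'.1, ~~ k'.2, g == e, p == p0 & q == q0]].

Definition reach (j : bool) p q g := if j then exists2 w, run E2 q w p & g = (val w)^-1
  else exists2 w, run E1 p w q & g = val w.

Definition around j p q g := exists g1 g2 r s,
  [/\ reach j p r g1, seam j r s, reach j s q g2 & g = g1 * g2].

Lemma reach_refl j p : reach j p p 1.
Proof. by case: j; exists [::]; rewrite ?big_nil ?invg1. Qed.

Lemma reach_trans j p q r g h : reach j p q g -> reach j q r h -> reach j p r (g * h).
Proof.
case: j => -[v rv ->] [w rw ->].
  by exists (w ++ v); [apply/run_cat; exists q | rewrite big_cat invgM].
by exists (v ++ w); [apply/run_cat; exists q | rewrite big_cat].
Qed.

Lemma reach_letter j p q g : letter_step j g p q -> reach j p q g.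
Proof.
by case: j => /existsP[a /andP[/eqP-> Ea]]; exists [:: a]; rewrite ?big_seq1 //;
  [exists p | exists q].
Qed.

(** The part before the seam is moved behind the part after it, which is a conjugation by the value
    of the former. *)
Lemma around_accepted1 p g : around false p p g ->
  exists2 w, accepted E1 I1 F1 w & exists h, h * val w = g * h.
Proof.
case=> _ [_ [r [s [[v pr ->] /andP[Fr Is] [u sp ->] ->]]]].
exists (u ++ v); first by exists s, r; split=> //; apply/run_cat; exists p.
by exists (val v); rewrite big_cat mulgA.
Qed.

Lemma around_accepted2 p g : around true p p g ->
  exists2 w, accepted E2 I2 F2 w & exists h, h * val w = g^-1 * h.
Proof.
case=> _ [_ [r [s [[v rp ->] /andP[Ir Fs] [u ps ->] ->]]]].
exists (v ++ u); first by exists r, s; split=> //; apply/run_cat; exists p.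
by exists (val u); rewrite big_cat invgM !invgK mulgA.
Qed.

Lemma accepted_around1 w i : accepted E1 I1 F1 w -> exists p, around false p p (val (rot i w)).
Proof.
case=> s [r [Is Fr]]; rewrite -{1}(cat_take_drop i w) => /run_cat[p sp pr].
exists p, (val (drop i w)), (val (take i w)), r, s; split.
- by exists (drop i w).
- exact/andP.
- by exists (take i w).
- by rewrite /rot big_cat.
Qed.

Lemma accepted_around2 w i : accepted E2 I2 F2 w -> exists p, around true p p (val (rot i w))^-1.
Proof.
case=> s [r [Is Fr]]; rewrite -{1}(cat_take_drop i w) => /run_cat[p sp pr].
exists p, (val (take i w))^-1, (val (drop i w))^-1, s, r; split.
- by exists (take i w).
- exact/andP.
- by exists (drop i w).
- by rewrite /rot big_cat invgM.
Qed.

Variable N : nat.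
Hypotheses (E1N : forall a p q, E1 a p q -> p < N /\ q < N)
  (E2N : forall a p q, E2 a p q -> p < N /\ q < N).
Hypotheses (I1N : forall p, I1 p -> p < N) (F1N : forall p, F1 p -> p < N).
Hypotheses (I2N : forall p, I2 p -> p < N) (F2N : forall p, F2 p -> p < N).

Lemma letter_stepN j g p q : letter_step j g p q -> p < N /\ q < N.
Proof. by case: j => /existsP[a /andP[_]]; [case/E2N | apply: E1N]. Qed.

Lemma seamN j p q : seam j p q -> p < N /\ q < N.
Proof. by case: j => /andP[? ?]; split; eauto. Qed.

(** An empty run is possible at any number, so only the equivalence of the two bounds holds. *)
Lemma reachN j p q g : reach j p q g -> (p < N) = (q < N).
Proof.
have runN (E : A -> nat -> nat -> bool) p' w q' :
    (forall a p q, E a p q -> p < N /\ q < N) -> run E p' w q' -> (p' < N) = (q' < N).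
  by move=> EN; elim: w p' => [|a w IH] p' /= => [->//|[r /EN[-> rN] /IH <-]]; rewrite rN.
by case: j => -[w rw _]; [rewrite (runN _ _ _ _ E2N rw) | rewrite (runN _ _ _ _ E1N rw)].
Qed.

Lemma aroundN j p q g : around j p q g -> p < N.
Proof. by case=> g1 [g2 [r [s [/reachN -> /seamN[]]]]]. Qed.

Section Bridge.

Variables (e : G) (p0 q0 : nat).
Hypotheses (p0N : p0 < N) (q0N : q0 < N).

Lemma layer_stepN k g k' p q : layer_step e p0 q0 k g k' p q -> p < N /\ q < N.
Proof.
case/or3P=> [/andP[_ /letter_stepN]//|/and5P[_ _ _ _ /seamN]//|].
by case/and5P=> _ _ _ _ /and3P[_ /eqP-> /eqP->].
Qed.

Definition inside j (k : bool) := if k then around j else reach j.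

(* What is known about the value [g] of a walk that starts in the layer
   [(j, false)] at the state [p]. *)
Definition traced j p (k : bool * bool) q g :=
  if k.1 == j then inside j k.2 p q g else
  ~~ j /\ exists g1 g2, [/\ around false p p0 g1, inside true k.2 q0 q g2 & g = g1 * e * g2].

Lemma inside_step j k k' p q r g h : inside j k p q g ->
  layer_step e p0 q0 (j, k) h (j, k') q r -> inside j k' p r (g * h).
Proof.
move=> pq /or3P[/andP[/eqP[<-] /= /reach_letter qr]
  |/and5P[_ /= /negPf k0 k'1 /eqP-> qr]|]; last first.
- by case/and5P=> /negPf /= ->.
- rewrite k0 in pq; rewrite k'1; exists g, 1, q, r; split=> //; exact: reach_refl.
case: k pq => /= pq; last exact: reach_trans qr.
case: pq => g1 [g2 [s [t [? ? tq ->]]]]; exists g1, (g2 * h), s, t.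
by split=> //; [exact: reach_trans qr | rewrite mulgA].
Qed.

Lemma traced_step j p k k' q r g h : traced j p k q g ->
  layer_step e p0 q0 k h k' q r -> traced j p k' r (g * h).
Proof.
case: k k' => [j1 k1] [j2 k2]; rewrite /traced /=.
case: (altP (j2 =P j1)) => [->|j21] tr st.
  move: tr; case: eqP st => [-> st tr|/eqP jj st [/negPf jF [g1 [g2 [a1 i2 ->]]]]].
    exact: inside_step st.
  subst j; case: j1 jj st => // _ st.
  split=> //; exists g1, (g2 * h); split=> //; last by rewrite !mulgA.
  exact: inside_step st.
case/or3P: st tr => [/andP[/eqP[e12]]|/and5P[/= /eqP e12]|]; try by rewrite e12 eqxx in j21.
case/and5P=> /= /negPf -> -> -> /negPf -> /and3P[/eqP-> /eqP-> /eqP->].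
case: j => [[]//|] tr; split=> //; exists g, 1; split=> //; last by rewrite mulg1.
exact: reach_refl.
Qed.

End Bridge.

(** * The decision by path questions, its soundness and completeness *)

Section Deciding.

Variables (R : rel G) (B : seq G).
Hypotheses (Rrefl : reflexive R) (Rsym : symmetric R) (Rsimp : simplicial R).
Hypothesis RB : forall g g', R g g' -> g^-1 * g' \in B.
Hypotheses (Rf : forall g a, R g (g * f a)) (RfV : forall g a, R g (g / f a)).

Local Notation layer := (bool * bool)%type.
(** Layers and labels form a finite type independent of the input, whereas the states are
    numbers. *)
Local Notation kind := (layer * seq_sub B * layer)%type.

Definition comp_rule (k1 k2 k : kind) : bool :=
  [&& k1.1.1 == k.1.1, k1.2 == k2.1.1, k2.2 == k.2 &
      ssval k.1.2 == ssval k1.1.2 * ssval k2.1.2].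

Definition layer_base e p0 q0 (k : kind) p q : bool :=
  layer_step e p0 q0 k.1.1 (ssval k.1.2) k.2 p q.

Definition layer_gen e p0 q0 := generated comp_rule (layer_base e p0 q0).

Definition vertex_step e p0 q0 (v : layer * nat) g (u : layer * nat) : Prop :=
  layer_step e p0 q0 v.1 g u.1 v.2 u.2.

Lemma layer_gen_traced e p0 q0 k p q : layer_gen e p0 q0 k p q ->
  forall j p' h, traced e p0 q0 j p' k.1.1 p h -> traced e p0 q0 j p' k.2 q (h * ssval k.1.2).
Proof.
elim=> {k p q} [k p q st j p' h tr|k1 k2 k p q r _ IH1 _ IH2]; first exact: traced_step tr st.
case/and4P=> /eqP e1 /eqP e2 /eqP e3 /eqP e4 j p' h tr.
by rewrite e4 mulgA -e3; apply: IH2; rewrite -e2; apply: IH1; rewrite e1.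
Qed.

(** Saturation applied to the layered graph: [Re] makes the bridge an edge of [R], and distinct
    layers at the ends exclude the empty walk. *)
Lemma walk_layer_gen e p0 q0 k g k' p q : (forall h, R h (h * e)) -> k <> k' -> R 1 g ->
  walk (vertex_step e p0 q0) (k, p) g (k', q) ->
  exists2 b : seq_sub B, ssval b = g & layer_gen e p0 q0 (k, b, k') p q.
Proof.
move=> Re kk' Rg wk.
pose S (v : layer * nat) g (u : layer * nat) := exists2 b : seq_sub B, ssval b = g &
  layer_gen e p0 q0 (v.1, b, u.1) v.2 u.2.
have stepR h v a u : vertex_step e p0 q0 v a u -> R h (h * a).
  case/or3P=> [/andP[_]|/and5P[_ _ _ /eqP-> _]|/and5P[_ _ _ _ /and3P[/eqP-> _ _]]] //.
    by case: v.1.1 => /existsP[b /andP[/eqP-> _]].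
  by rewrite mulg1.
apply: (@walk_saturated G R B Rsym Rsimp RB _ (vertex_step e p0 q0) S stepR _ _ _ _ _ wk) => //.
- move=> v a u vu; have aB : a \in B by have := RB (stepR 1 _ _ _ vu); rewrite mulKg.
  by exists (SeqSub aB) => //; apply: generated_base.
- move=> v _ u _ w [b1 <- g1] [b2 <- g2] bB.
  exists (SeqSub bB) => //; apply: (generated_comp g1 g2).
  by rewrite /comp_rule /= !eqxx.
- by case.
Qed.

Lemma walk_reach e p0 q0 j k p q g : reach j p q g ->
  walk (vertex_step e p0 q0) ((j, k), p) g ((j, k), q).
Proof.
have st a p' q' : letter_step j a p' q' ->
    walk (vertex_step e p0 q0) ((j, k), p') a ((j, k), q').
  by move=> pq'; apply: walk_step; rewrite /vertex_step /layer_step /= eqxx pq'.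
case: j st => st [w rw ->] {g}.
  elim: w q rw => [|a w IH] q /=; first by rewrite big_nil invg1 => ->; apply: walk_nil.
  case=> r qr rp; rewrite big_cons invgM; apply: walk_cat (IH _ rp) _; apply: st.
  by apply/existsP; exists a; rewrite eqxx.
elim: w p rw => [|a w IH] p /=; first by rewrite big_nil => ->; apply: walk_nil.
case=> r pr rq; rewrite big_cons; apply: walk_cat (IH _ rq); apply: st.
by apply/existsP; exists a; rewrite eqxx.
Qed.

Lemma walk_around e p0 q0 j p q g : around j p q g ->
  walk (vertex_step e p0 q0) ((j, false), p) g ((j, true), q).
Proof.
case=> g1 [g2 [r [s [pr rs sq ->]]]]; apply: walk_cat (walk_reach _ _ _ _ sq).
rewrite -[g1]mulg1; apply: walk_cat (walk_reach _ _ _ _ pr) (walk_step _).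
by rewrite /vertex_step /layer_step /= !eqxx rs orbT.
Qed.

(** In the first case rotations with values [x] and [y] satisfy [x * e * y^-1 = e], so a walk across
    the bridge [e] has value [e] again. In the second case both values lie in a finite table; the
    second automaton yields the inverse of [y], whence [(ssval d2)^-1]. *)
Definition conj_decision : bool :=
  [exists e : seq_sub B, ex_lt N (fun p => ex_lt N (fun q =>
     generatedb comp_rule (layer_base (ssval e) p q) N
       ((false, false), e, (true, true)) p q))] ||
  [exists d1 : seq_sub B, [exists d2 : seq_sub B,
     [&& `[< conjugate (ssval d1) (ssval d2)^-1 >],
         ex_lt N (fun p => generatedb comp_rule (layer_base 1 p p) N
           ((false, false), d1, (false, true)) p p) &
         ex_lt N (fun q => generatedb comp_rule (layer_base 1 q q) N
           ((true, false), d2, (true, true)) q q)]]].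

Lemma generatedbP e p0 q0 k p q : p0 < N -> q0 < N -> p < N -> q < N ->
  reflect (layer_gen e p0 q0 k p q)
    (generatedb comp_rule (layer_base e p0 q0) N k p q).
Proof.
by move=> ? ? ? ?; apply: generatedP => // k' p' q'; apply: layer_stepN.
Qed.

Lemma conjugateP (x y h : G) : h * x = y * h -> conjugate x y.
Proof. by move=> hx; exists h; rewrite -mulgA -hx mulKg. Qed.

Lemma conjugate_sym (x y : G) : conjugate x y -> conjugate y x.
Proof. by case=> h ->; apply: (@conjugateP _ _ h^-1); rewrite mulgK. Qed.

Lemma conjugate_trans (x y z : G) : conjugate x y -> conjugate y z -> conjugate x z.
Proof. by case=> h -> [k ->]; exists (k * h); rewrite invgM !mulgA. Qed.

Lemma conj_decision_sound : conj_decision ->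
  exists w1 w2, [/\ accepted E1 I1 F1 w1, accepted E2 I2 F2 w2 & conjugate (val w1) (val w2)].
Proof.
case/orP=> [/existsP[e /ex_ltP[p pN /ex_ltP[q qN /generatedbP gen]]]|].
  have [|_ [g1 [g2 [a1 a2 eE]]]] :=
    layer_gen_traced (gen pN qN pN qN) (j := false) (p' := p) (h := 1).
    exact: reach_refl.
  have [w1 acc1 [h1 c1]] := around_accepted1 a1.
  have [w2 acc2 [h2 c2]] := around_accepted2 a2.
  exists w1, w2; split=> //; apply: conjugate_trans (conjugateP c1) _.
  apply/conjugate_sym/(conjugate_trans (conjugateP c2))/(@conjugateP _ _ (ssval e)).
  by rewrite mul1g /= in eE; rewrite {1}eE mulgK.
case/existsP=> d1 /existsP[d2 /and3P[/asboolP cd /ex_ltP[p pN /generatedbP gen1]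
  /ex_ltP[q qN /generatedbP gen2]]].
have := layer_gen_traced (gen1 pN pN pN pN) (j := false) (p' := p) (h := 1) (reach_refl _ _).
have := layer_gen_traced (gen2 qN qN qN qN) (j := true) (p' := q) (h := 1) (reach_refl _ _).
rewrite !mul1g /traced /= => a2 a1.
have [w1 acc1 [h1 c1]] := around_accepted1 a1.
have [w2 acc2 [h2 c2]] := around_accepted2 a2.
exists w1, w2; split=> //; apply: conjugate_trans (conjugateP c1) _.
exact/(conjugate_trans cd)/conjugate_sym/(conjugateP c2).
Qed.

Lemma conj_decision_complete (B0 D0 : seq G) w1 w2 :
  (forall g, exists w, val w = g) ->
  (forall z w1 w2 : seq A, val z * val w1 = val w2 * val z -> exists i j,
    (exists2 e, e \in B0 & val (rot j w2) * e = e * val (rot i w1)) \/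
    (val (rot i w1) \in D0 /\ val (rot j w2) \in D0)) ->
  (forall e, e \in B0 -> forall g, R g (g * e^-1)) ->
  (forall d, d \in D0 -> R 1 d /\ R 1 d^-1) ->
  accepted E1 I1 F1 w1 -> accepted E2 I2 F2 w2 -> conjugate (val w1) (val w2) ->
  conj_decision.
Proof.
move=> surj ann RB0 RD0 acc1 acc2 [h wE]; have [z zE] := surj h.
have [|i [j ij]] := ann z w1 w2; first by rewrite zE wE -!mulgA mulVKg.
have [p a1] := accepted_around1 i acc1; have [q a2] := accepted_around2 j acc2.
have pN := aroundN a1; have qN := aroundN a2.
apply/orP; case: ij => [[e eB eE]|[D1 D2]]; [left | right].
  have Re := RB0 _ eB.
  have [|||b bE gen] := @walk_layer_gen e^-1 p q (false, false) e^-1 (true, true) p q Re.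
  - by [].
  - by have := Re 1; rewrite mul1g.
  (* The bridge carries [e^-1], and this equation displays the value of the walk: once around the
     first automaton, over the bridge, once around the second. *)
  - have eE' : e^-1 = val (rot i w1) * (e^-1 * (val (rot j w2))^-1).
      by rewrite -invgM eE invgM mulVKg.
    rewrite [X in walk _ _ X _]eE'.
    apply: walk_cat (walk_around _ _ _ a1) _.
    apply: walk_cat (walk_around _ _ _ a2); apply: walk_step.
    by rewrite /vertex_step /layer_step /= !eqxx.
  apply/existsP; exists b; apply/ex_ltP; exists p => //; apply/ex_ltP; exists q => //.
  by apply/generatedbP => //; rewrite bE.
have R1 h' : R h' (h' * 1) by rewrite mulg1.
have [||b1 b1E gen1] := walk_layer_gen R1 _ _ (walk_around 1 p p a1); first by [].
  exact: (RD0 _ D1).1.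
have [||b2 b2E gen2] := walk_layer_gen R1 _ _ (walk_around 1 q q a2); first by [].
  exact: (RD0 _ D2).2.
apply/existsP; exists b1; apply/existsP; exists b2; apply/and3P; split.
- apply/asboolP; rewrite b1E b2E invgK.
  have rotC k w : conjugate (val (rot k w)) (val w).
    apply: (@conjugateP _ _ (val (take k w))).
    have -> : val w = val (take k w) * val (drop k w) by rewrite -big_cat cat_take_drop.
    by rewrite /rot big_cat mulgA.
  apply: conjugate_trans (rotC _ _) (conjugate_trans _ (conjugate_sym (rotC _ _))).
  by exists h.
- by apply/ex_ltP; exists p => //; apply/generatedbP.
- by apply/ex_ltP; exists q => //; apply/generatedbP.
Qed.

End Deciding.

End LayeredGraph.

(** * Codes of automata *)

Section NfaCodes.

Variable A : finType.

Definition code_edge (c : nat) (a : A) (p q : nat) : bool :=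
  code_mem (pair_code (pair_code p (pickle a)) q) c.

Lemma code_mem_ltn x c : code_mem x c -> x < c.
Proof.
by case/ex_ltP=> i _ /and3P[_ _ /bit_ltn]; apply: leq_ltn_trans (leq_addl _ _).
Qed.

(** A code exceeds every state it mentions, so the sum of the codes can serve as the bound [N]. *)
Lemma code_edge_ltn c a p q : code_edge c a p q -> p < c /\ q < c.
Proof.
have /andP[pp _] := ltn_pair_code p (pickle a).
have /andP[pq qq] := ltn_pair_code (pair_code p (pickle a)) q.
move=> /code_mem_ltn ltc; split; first exact: ltn_trans (ltn_trans pp pq) ltc.
exact: ltn_trans qq ltc.
Qed.

Definition edge_code (M : nfa A) : nat := CodeSeq.code (map pickle (edges M)).

Lemma nfa_codeE (M : nfa A) : nfa_code M =
  pair_code (pair_code (CodeSeq.code (initial M)) (CodeSeq.code (final M))) (edge_code M).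
Proof.
rewrite -[in RHS](map_id (initial M)) -[in RHS](map_id (final M)).
by [].
Qed.

Lemma code_edgeE (M : nfa A) a p q : code_edge (edge_code M) a p q = ((p, a, q) \in edges M).
Proof.
rewrite /code_edge code_memE -(mem_map (pcan_inj (@pickleK (nat * A * nat)%type))).
by [].
Qed.

Lemma accepts_fromP (M : nfa A) p w : accepts_from M p w <->
  exists2 q, q \in final M & run (code_edge (edge_code M)) p w q.
Proof.
elim: w p => [|a w IH] p /=; first by split=> [|[q ? ->]//]; exists p.
split=> [/hasP[[[p' a'] r] ed /andP[/= /eqP[ep ea] /IH[q qF rq]]]|[q qF [r ed rq]]].
  by exists q => //; exists r => //; rewrite code_edgeE -ep -ea.
rewrite code_edgeE in ed; apply/hasP; exists (p, a, r) => //=.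
by rewrite eqxx; apply/IH; exists q.
Qed.

Lemma acceptsP (M : nfa A) w : accepts M w <->
  accepted (code_edge (edge_code M)) (code_mem^~ (CodeSeq.code (initial M)))
    (code_mem^~ (CodeSeq.code (final M))) w.
Proof.
split=> [/hasP[p pI /accepts_fromP[q qF pq]]|[p [q [pI qF pq]]]].
  by exists p, q; rewrite !code_memE.
rewrite !code_memE in pI qF; apply/hasP; exists p => //.
by apply/accepts_fromP; exists q.
Qed.

End NfaCodes.

(** Decoding is a bounded search: the components of a pair are below its code, and injectivity of
    pairing makes the solution unique. *)
Lemma nfa_rel_decidable_from_codes (A : finType) (P : nfa A -> nfa A -> Prop)
    (d : nat -> nat -> nat -> nat -> nat -> nat -> bool) :
  computable 6 (fun e => d (e 5) (e 4) (e 3) (e 2) (e 1) (e 0)) ->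
  (forall M1 M2, P M1 M2 <->
    d (CodeSeq.code (initial M1)) (CodeSeq.code (final M1)) (edge_code M1)
      (CodeSeq.code (initial M2)) (CodeSeq.code (final M2)) (edge_code M2)) ->
  nfa_rel_decidable P.
Proof.
move=> rd dP.
pose D c1 c2 := ex_lt c1 (fun i1 => ex_lt c1 (fun f1 => ex_lt c1 (fun e1 =>
  ex_lt c2 (fun i2 => ex_lt c2 (fun f2 => ex_lt c2 (fun e2 =>
  [&& c1 == pair_code (pair_code i1 f1) e1, c2 == pair_code (pair_code i2 f2) e2 &
      d i1 f1 e1 i2 f2 e2])))))).
have rD : computable 2 (fun e => D (e 0) (e 1)).
  have {}rd : computable 8 (fun e => d (e 5) (e 4) (e 3) (e 2) (e 1) (e 0)).
    exact: (@computable_insert 7 7 _ _ (@computable_insert 6 6 _ _ rd)).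
  by rewrite /D; computability.
exists (fun t => D (nth 0 t 0) (nth 0 t 1)); first exact: rD.
have pair_inj a b a' b' : pair_code a b = pair_code a' b' -> a = a' /\ b = b'.
  by move/(pcan_inj pickleK) => [-> ->].
have DE i1 f1 e1 i2 f2 e2 : D (pair_code (pair_code i1 f1) e1) (pair_code (pair_code i2 f2) e2)
    = d i1 f1 e1 i2 f2 e2.
  have lt3 i f e : [/\ i < pair_code (pair_code i f) e, f < pair_code (pair_code i f) e
      & e < pair_code (pair_code i f) e].
    have /andP[lti ltf] := ltn_pair_code i f.
    by have /andP[ltp lte] := ltn_pair_code (pair_code i f) e; split=> //; apply: ltn_trans ltp.
  apply/idP/idP => [|di].
    do 6!case/ex_ltP=> ? _; case/and3P=> /eqP/pair_inj[/pair_inj[-> ->] ->].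
    by case/eqP/pair_inj=> /pair_inj[-> ->] ->.
  have [? ? ?] := lt3 i1 f1 e1; have [? ? ?] := lt3 i2 f2 e2.
  apply/ex_ltP; exists i1 => //; apply/ex_ltP; exists f1 => //; apply/ex_ltP; exists e1 => //.
  apply/ex_ltP; exists i2 => //; apply/ex_ltP; exists f2 => //; apply/ex_ltP; exists e2 => //.
  by rewrite !eqxx.
by move=> M1 M2; rewrite dP /= !nfa_codeE DE; case: (d _ _ _ _ _ _).
Qed.

Section CodedDecision.

Variables (G : groupType) (A : finType) (f : A -> G) (B : seq G).

Definition coded_decision i1 f1 e1 i2 f2 e2 : bool :=
  conj_decision f (code_edge e1) (code_edge e2)
    (code_mem^~ i1) (code_mem^~ f1) (code_mem^~ i2) (code_mem^~ f2)
    (i1 + f1 + e1 + i2 + f2 + e2) B.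

(** For fixed kinds, all comparisons in the group are constants; the input enters through membership
    in coded lists, comparison of states and the bound. *)
Lemma computable_coded_decision :
  computable 6 (fun e => coded_decision (e 5) (e 4) (e 3) (e 2) (e 1) (e 0)).
Proof.
rewrite /coded_decision /conj_decision.
repeat first [apply: computable_generated | computability_step];
  case=> [[[j1 k1] b] [j2 k2]]; rewrite /layer_base /layer_step /letter_step /seam /code_edge /=;
  by case: j1; repeat first [apply: computable_code_mem | computability_step].
Qed.

End CodedDecision.

Theorem corollary3p22 (G : groupType) (n : nat) (X : n.-tuple G) :
  generates (tnth X) ->
  virtually_free G ->
  nfa_rel_decidable (fun M1 M2 : nfa ('I_n * bool) =>
    exists x y : G,
      [/\ rational_subset X M1 x, rational_subset X M2 y & conjugate x y]).
Proof.
move=> genX vfG; pose f := letter_val (tnth X).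
pose L := [seq f a | a : 'I_n * bool].
have fL a : f a \in L by apply: image_f.
have fV a : f (inv_letter a) = (f a)^-1%g by apply: letter_val_inv.
(* The first graph serves to obtain from [annulus] the finite sets of conjugators and of exceptional
   rotations. *)
have [R0 [B0 [R0refl R0sym R0L R0B R0simp]]] := virtually_free_chordal L genX vfG.
have genX' g : exists w, (\prod_(a <- w) f a)%g == g by have [w <-] := genX g; exists w.
pose word g := xchoose (genX' g).
have wordK g : (\prod_(a <- word g) f a = g)%g by apply/eqP/(xchooseP (genX' g)).
have [D0 ann] := annulus R0refl R0sym R0simp R0B (fun g a => R0L g _ (fL a)) wordK.
(* The elements of [B0] and [D0] label chords of the first graph only where it
   has them; in the second graph they are steps everywhere. *)
pose L1 := L ++ [seq e^-1%g | e <- B0] ++ D0 ++ [seq d^-1%g | d <- D0].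
have [R [B [Rrefl Rsym RL RB Rsimp]]] := virtually_free_chordal L1 genX vfG.
have RL0 g a : a \in L -> R g (g * a)%g by move=> aL; apply: RL; rewrite mem_cat aL.
have Rf g a : R g (g * f a)%g by apply: RL0.
have RfV g a : R g (g / f a)%g by rewrite -fV.
apply: (nfa_rel_decidable_from_codes (computable_coded_decision f B)).
move=> M1 M2; set i1 := CodeSeq.code (initial M1); set f1 := CodeSeq.code (final M1).
set i2 := CodeSeq.code (initial M2); set f2 := CodeSeq.code (final M2).
set e1 := edge_code M1; set e2 := edge_code M2; rewrite /coded_decision.
set N := (i1 + f1 + e1 + i2 + f2 + e2)%N.
have ltN c x : c <= N -> x < c -> x < N by move=> cN xc; apply: leq_trans cN.
have i1N : i1 <= N by rewrite /N -!addnA leq_addr.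
have f1N : f1 <= N by rewrite /N -!addnA addnCA leq_addr.
have e1N : e1 <= N by rewrite /N -!addnA addnA addnCA leq_addr.
have i2N : i2 <= N by rewrite /N -2!addnA addnCA leq_addr.
have f2N : f2 <= N by rewrite /N -addnA addnCA leq_addr.
have e2N : e2 <= N by rewrite /N leq_addl.
have memN c x : c <= N -> code_mem x c -> x < N by move=> cN /code_mem_ltn/(ltN _ _ cN).
have edgeN c (a : 'I_n * bool) p q : c <= N -> code_edge c a p q -> p < N /\ q < N.
  by move=> cN /code_edge_ltn[/(ltN _ _ cN) ? /(ltN _ _ cN) ?].
split=> [[x [y [[w1 acc1 <-] [w2 acc2 <-] conjxy]]]|/conj_decision_sound].
  apply: (conj_decision_complete _ _ _ _ _ _ Rrefl Rsym Rsimp RB Rf RfV _ ann _ _ _ _ conjxy).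
  - by move=> a p q; apply: edgeN.
  - by move=> a p q; apply: edgeN.
  - by move=> p; apply: memN.
  - by move=> p; apply: memN.
  - by move=> p; apply: memN.
  - by move=> p; apply: memN.
  - by move=> g; exists (word g); apply: wordK.
  - by move=> e eB g; apply: RL; rewrite !mem_cat (map_f (fun h => h^-1)%g eB) orbT.
  - move=> d dD; split; [rewrite -[d]mul1g|rewrite -[(d^-1)%g]mul1g]; apply: RL.
      by rewrite !mem_cat dD !orbT.
    by rewrite !mem_cat (map_f (fun h => h^-1)%g dD) !orbT.
  - exact/acceptsP.
  - exact/acceptsP.
case=> [a p q|a p q|p|p|p|p|w1 [w2 [acc1 acc2 cw]]]; try by [apply: edgeN|apply: memN].
exists (word_val (tnth X) w1), (word_val (tnth X) w2); split=> //.
  by exists w1 => //; apply/acceptsP.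
by exists w2 => //; apply/acceptsP.
Qed.
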